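(* Let $N$ be a finite dimensional $C^*$-algebra with a faithful positive linear functional $\nu\colon N\to\mathbb C$ of index $1$. Let $\beta,\alpha,\hat\beta$ be mutually commuting actions of $N$, $N^o$, and $N$, respectively, on a finite dimensional Hilbert space $\mathcal H$, put $E=(\alpha\otimes\beta)(e_\nu)$ and $\hat E=(\hat\beta\otimes\alpha)(e_\nu)$, and let $U\colon\hat E(\mathcal H\otimes\mathcal H)\to E(\mathcal H\otimes\mathcal H)$ be a pseudo-multiplicative unitary with respect to these data. Then $V:=EU\hat E\in\mathcal L(\mathcal H\otimes\mathcal H)$ (i.e. $V$ equals $U$ on $\hat E(\mathcal H\otimes\mathcal H)$ and $0$ on its orthogonal complement) is a multiplicative partial isometry on $\mathcal H$, with $VV^*=E$ and $V^*V=\hat E$.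
   Context: Leg notation: $X_{ij}$ denotes $X\in\mathcal L(\mathcal H\otimes\mathcal H)$ acting on the $i$-th and $j$-th tensor factors (in this order) of $\mathcal H\otimes\mathcal H\otimes\mathcal H$. Actions are given by ${}^*$-homomorphisms $\beta,\hat\beta\colon N\to\mathcal L(\mathcal H)$, $\alpha\colon N^o\to\mathcal L(\mathcal H)$ ($N^o$ the opposite algebra); they are not required to map the unit to $\mathrm{id}_{\mathcal H}$. The element $e_\nu$. Let $\{a_i\}$ be a basis of $N$ and $\{b_i\}$ the dual basis: $\nu(b_ia_j)=\delta_{ij}$. The index of $\nu$ is the positive invertible central element $\sum_ia_ib_i$. The modular automorphism $\theta_\nu$ is the automorphism of $N$ with $\nu(xy)=\nu(y\theta_\nu(x))$ for all $x,y$; it is of the form $\theta_\nu(x)=gxg^{-1}$ with $g\in N$ positive invertible, and $\theta_\nu^{1/2}(x)=g^{1/2}xg^{-1/2}$. For $\nu$ of index $1$ put $e_\nu=\sum_ia_i\otimes\theta_\nu^{1/2}(b_i)$, a Hermitean idempotent of $N^o\otimes N$, invariant under the flip of the tensor factors (so it may also be regarded as an element of $N\otimes N^o$). The subspaces $\hat E(\mathcal H\otimes\mathcal H)$ and $E(\mathcal H\otimes\mathcal H)$ are the relative tensor products $\mathcal H_{\hat\beta}\otimes_{\nu^o}{}_{\alpha}\mathcal H$ and $\mathcal H_{\alpha}\otimes_{\nu}{}_{\beta}\mathcal H$, respectively. A pseudo-multiplicative unitary with respect to these data is a unitary $U\colon\hat E(\mathcal H\otimes\mathcal H)\to E(\mathcal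 H\otimes\mathcal H)$ such that (i) for all $x\in N$: $U(\beta(x)\otimes\mathrm{id})=(\beta(x)\otimes\mathrm{id})U$, $U(\mathrm{id}\otimes\beta(x))=(\hat\beta(x)\otimes\mathrm{id})U$, $U(\mathrm{id}\otimes\hat\beta(x))=(\mathrm{id}\otimes\hat\beta(x))U$, $U(\alpha(x)\otimes\mathrm{id})=(\mathrm{id}\otimes\alpha(x))U$, as maps on $\hat E(\mathcal H\otimes\mathcal H)$ (each operator preserves the subspace on which it acts); (ii) the pentagon equation holds: as maps $\hat E_{12}\hat E_{23}(\mathcal H^{\otimes3})\to E_{12}E_{23}(\mathcal H^{\otimes3})$, $U_{23}\circ U_{12}=U_{12}\circ\Sigma_{12}\circ U_{23}\circ\Sigma_{12,3}\circ\Sigma_{23}\circ U_{23}$, where $\Sigma_{ij}$ is the flip of factors $i,j$, $\Sigma_{12,3}(\xi\otimes\eta\otimes\zeta)=\zeta\otimes\xi\otimes\eta$, and each factor is restricted to the appropriate subspace; on the left the successive subspaces are $\hat E_{12}\hat E_{23}$, $E_{12}\hat E_{23}$, $E_{12}E_{23}$, and on the right they are $\hat E_{12}\hat E_{23}$, $\hat E_{13}E_{23}$, $\hat E_{12}E_{32}$, $E_{13}\hat E_{23}$, $\hat E_{21}E_{23}$, $E_{13}\hat E_{12}$, $E_{12}E_{23}$ (each applied to $\mathcal H^{\otimes3}$). A multiplicative partial isometry on $\mathcal H$ is $V\in\mathcal L(\mathcal H\otimes\mathcal H)$ with $VV^*V=V$ and $$V_{23}V_{12}=V_{12}V_{13}V_{23},\quad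 V_{13}V_{23}V_{23}^*=V_{12}^*V_{12}V_{13},\quad V_{12}V_{12}^*V_{23}=V_{23}V_{12}V_{12}^*,\quad V_{12}V_{23}^*V_{23}=V_{23}^*V_{23}V_{12}.$$ *)

(* Defs.v *)
From HB Require Import structures.
From mathcomp Require Import all_boot all_order all_algebra.
From mathcomp Require Import falgebra reals complex mxtens.

Set Implicit Arguments.
Unset Strict Implicit.
Unset Printing Implicit Defensive.

Import Order.TTheory GRing.Theory Num.Theory.
Local Open Scope ring_scope.
Local Open Scope sesquilinear_scope.
Local Open Scope complex_scope.

Notation "A *t B" := (tensmx A B)
  (at level 40, left associativity, format "A  *t  B") : ring_scope.

Section CstarAlgebra.
Variables (R : realType) (N : falgType R[i]).
Implicit Types (star : N -> N) (nu : {scalar N}).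

(* Completeness of the norm is automatic, since N is finite dimensional. *)
Record is_cstar_algebra star (norm : N -> R) : Prop := IsCstarAlgebra {
  cstarK : involutive star;
  cstarD : forall x y, star (x + y) = star x + star y;
  cstarZ : forall (c : R[i]) x, star (c *: x) = c^* *: star x;
  cstarM : forall x y, star (x * y) = star y * star x;
  cnorm_eq0 : forall x, norm x = 0 -> x = 0;
  cnormD : forall x y, norm (x + y) <= norm x + norm y;
  cnormZ : forall (c : R[i]) x, (norm (c *: x))%:C = `|c| * (norm x)%:C;
  cnormM : forall x y, norm (x * y) <= norm x * norm y;
  cnorm_star : forall x, norm (star x * x) = norm x ^+ 2
}.

Definition positive star (x : N) := exists y, x = star y * y.

(* In R[i], 0 <= z means that z is real and nonnegative. *)
Definition positive_functional star nu :=
  forall x, positive star x -> 0 <= nu x.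

Definition faithful star nu :=
  forall x, positive star x -> nu x = 0 -> x = 0.

Definition dual_bases nu m (a b : m.-tuple N) :=
  [/\ basis_of fullv a, basis_of fullv b &
      forall i j, nu (tnth b i * tnth a j) = (i == j)%:R].

Definition index_elt m (a b : m.-tuple N) : N :=
  \sum_(i < m) tnth a i * tnth b i.

(* For faithful nu this equation determines theta, and forces it to be an
   algebra automorphism. *)
Definition modular_automorphism nu (theta : N -> N) :=
  forall x y, nu (x * y) = nu (y * theta x).

(* theta = Ad g and thetah = Ad (g ^ 1/2), where h is the positive square root
   of the positive invertible element g. The choice of g does not matter: it
   is unique up to a positive invertible central factor. *)
Definition half_automorphism star (theta thetah : N -> N) :=
  exists g h : N,
    [/\ positive star g, g \is a GRing.unit, positive star h, h * h = g &
        (forall x, theta x = g * x * g^-1) /\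
        (forall x, thetah x = h * x * h^-1)].

End CstarAlgebra.

(* A finite dimensional Hilbert space is written in an orthonormal basis: it is
   'cV[C]_n with inner product (v, w) |-> v^t* *m w, its operators are the
   matrices 'M[C]_n acting by left multiplication, and A (x) B is A *t B. *)
Section Operators.
Variable C : numClosedFieldType.

Definition in_range n (P : 'M[C]_n) (v : 'cV[C]_n) := exists w, v = P *m w.

Variable n : nat.
Implicit Types (X : 'M[C]_(n * n)).

(* The k-th tensor coordinate, k = 0, 1, 2, of an index of the standard basis
   of the threefold tensor power, grouped as (H (x) H) (x) H. *)
Definition coord3 (p : 'I_(n * n * n)) (k : 'I_3) : 'I_n :=
  let q := mxtens_unindex (mxtens_unindex p).1 in
  tnth [tuple q.1; q.2; (mxtens_unindex p).2] k.

(* X acting on the factors i and j, in this order, for i != j. *)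
Definition leg (i j : 'I_3) X : 'M[C]_(n * n * n) :=
  \matrix_(p, q)
    (X (mxtens_index (coord3 p i, coord3 p j))
       (mxtens_index (coord3 q i, coord3 q j))
     * [forall k, (k \notin [:: i; j]) ==> (coord3 p k == coord3 q k)]%:R).

Definition leg12 := leg 0 1.
Definition leg13 := leg 0 2.
Definition leg23 := leg 1 2.

(* x (x) y |-> y (x) x *)
Definition flip : 'M[C]_(n * n) :=
  \matrix_(p, q) (((mxtens_unindex p).1 == (mxtens_unindex q).2) &&
                  ((mxtens_unindex p).2 == (mxtens_unindex q).1))%:R.

(* x (x) y (x) z |-> z (x) x (x) y *)
Definition cycle12_3 : 'M[C]_(n * n * n) :=
  \matrix_(p, q) [&& coord3 p 0 == coord3 q 2, coord3 p 1 == coord3 q 0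
                   & coord3 p 2 == coord3 q 1]%:R.

Record mult_partial_isometry (V : 'M[C]_(n * n)) : Prop :=
  MultPartialIsometry {
  mpi_partial : V *m V^t* *m V = V;
  mpi_pentagon : leg23 V *m leg12 V = leg12 V *m leg13 V *m leg23 V;
  mpi_13 : leg13 V *m leg23 V *m (leg23 V)^t*
           = (leg12 V)^t* *m leg12 V *m leg13 V;
  mpi_final : leg12 V *m (leg12 V)^t* *m leg23 V
              = leg23 V *m leg12 V *m (leg12 V)^t*;
  mpi_initial : leg12 V *m (leg23 V)^t* *m leg23 V
                = (leg23 V)^t* *m leg23 V *m leg12 V
}.

End Operators.

Section Actions.
Variables (R : realType) (N : falgType R[i]) (n : nat).
Let C : numClosedFieldType := R[i].
Implicit Types (star : N -> N) (f g : {linear N -> 'M[C]_n}).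

(* Not required to be unital. *)
Definition star_hom (mul : N -> N -> N) star f :=
  (forall x y, f (mul x y) = f x *m f y) /\
  (forall x, f (star x) = (f x)^t*).

Definition action star f := star_hom (fun x y => x * y) star f.

Definition op_action star f := star_hom (fun x y => y * x) star f.

Definition commuting f g := forall x y, f x *m g y = g y *m f x.

(* (f (x) g)(e_nu), where e_nu = sum_i a_i (x) thetah b_i. Since e_nu is
   invariant under the flip, the same formula represents it in N^o (x) N and
   in N (x) N^o. *)
Definition act_e m (a b : m.-tuple N) (thetah : N -> N) f g : 'M[C]_(n * n) :=
  \sum_(i < m) f (tnth a i) *t g (thetah (tnth b i)).

(* A linear map from the range of Eh to the range of E is given by a matrix U
   extending it; only the values of U on the range of Eh matter below. *)
Record pseudo_mult_unitary (beta alpha betah : {linear N -> 'M[C]_n})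
    (E Eh U : 'M[C]_(n * n)) : Prop := PseudoMultUnitary {
  pmu_range : forall v, in_range Eh v -> in_range E (U *m v);
  pmu_isometry : forall v w, in_range Eh v -> in_range Eh w ->
    (U *m v)^t* *m (U *m w) = v^t* *m w;
  pmu_surjective : forall w, in_range E w ->
    exists2 v, in_range Eh v & U *m v = w;
  pmu_beta1 : forall x v, in_range Eh v ->
    U *m ((beta x *t 1%:M) *m v) = (beta x *t 1%:M) *m (U *m v);
  pmu_beta2 : forall x v, in_range Eh v ->
    U *m ((1%:M *t beta x) *m v) = (betah x *t 1%:M) *m (U *m v);
  pmu_betah2 : forall x v, in_range Eh v ->
    U *m ((1%:M *t betah x) *m v) = (1%:M *t betah x) *m (U *m v);
  pmu_alpha1 : forall x v, in_range Eh v ->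
    U *m ((alpha x *t 1%:M) *m v) = (1%:M *t alpha x) *m (U *m v);
  pmu_pentagon : forall v, in_range (leg12 Eh *m leg23 Eh) v ->
    leg23 U *m (leg12 U *m v)
    = leg12 U *m (leg12 (flip C n) *m (leg23 U *m (cycle12_3 C n *m
        (leg23 (flip C n) *m (leg23 U *m v)))))
}.

End Actions.

(* Main.v *)
Require Import Defs.
From HB Require Import structures.
From mathcomp Require Import all_boot all_order all_algebra.
From mathcomp Require Import falgebra reals complex mxtens.
From mathcomp Require Import fingroup perm ring.

Set Implicit Arguments.
Unset Strict Implicit.
Unset Printing Implicit Defensive.

Import Order.TTheory GRing.Theory Num.Theory.
Local Open Scope ring_scope.
Local Open Scope sesquilinear_scope.

(** Everything rests on two facts about the Casimir tensor [sum_i a_i (x) b_i]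
of a functional [nu] with dual bases [a], [b]. It does not depend on the dual
bases, and an element multiplying the first leg on the left can be moved to
the second leg on the right. From independence, comparing the given dual bases
with their images under [thetah] and under the involution, the element
[e = sum_i a_i (x) thetah b_i] is flip invariant and self-adjoint; from the
sliding rule and index 1 it is idempotent. So [E] and [Eh] are orthogonal
projections, and [V = E U Eh] is a partial isometry from [Eh] onto [E]
([extension_initial], [extension_final]).

The intertwining relations of [U] hold on the range of [Eh] only. The
operators occurring in them commute with [Eh] and with [E] because the three
actions commute, so the relations hold for [V] on the whole space
([extension_intertwine]). Since [E] and [Eh] are built from the actions, moving
a leg of [V] past the legs of the actions moves it past legs of [E] and [Eh].
This gives the last two commutation relations of a multiplicative partial
isometry and [V_13 E_23 = Eh_12 V_13]; the latter uses the flip invariance of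
[e], because [V] carries the leg 3 of [E_23], where [beta] acts, to the leg 1
of [Eh_12], where [betah] acts.

For the pentagon, apply the pentagon of [U] to [Eh_12 Eh_23 w] and push the
two projections to the left: each of them meets a [U] and turns it into a
[V]. The flips and the cyclic shift in that equation compose to the
identity and only turn the middle [V_23] into [V_13]
([pentagon_extension], [leg13E]). *)

(** * Casimir tensors of dual bases *)

Section Casimir.
Variables (R : realType) (N : falgType R[i]) (nu : {scalar N}).
Variables (m : nat) (a b : m.-tuple N).
Hypothesis hab : dual_bases nu a b.

Lemma dual_free (c d : 'I_m -> N) :
  (forall i j, nu (d i * c j) = (i == j)%:R) -> free [tuple d i | i < m].
Proof.
move=> dc; apply/freeP => k k0 j.
have : nu ((\sum_(i < m) k i *: d i) * c j) = 0.
  rewrite (_ : \sum_(i < m) _ = 0) ?mul0r ?linear0 // -[RHS]k0.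
  by apply: eq_bigr => i _; rewrite -tnth_nth tnth_mktuple.
rewrite mulr_suml linear_sum (bigD1 j) //= big1 => [|i /negPf ij].
  by rewrite -scalerAl linearZ /= dc eqxx mulr1 addr0.
by rewrite -scalerAl linearZ /= dc ij mulr0.
Qed.

Lemma dual_basis (c d : 'I_m -> N) :
  (forall i j, nu (d i * c j) = (i == j)%:R) ->
  basis_of fullv [tuple d i | i < m].
Proof.
move=> dc; have [ba _ _] := hab.
by rewrite basisEfree (dual_free dc) subvf (size_basis ba) size_tuple /=.
Qed.

Lemma dual_expand_l x : x = \sum_(i < m) nu (tnth b i * x) *: tnth a i.
Proof.
have [ba _ nuba] := hab.
have {1 2}-> := coord_basis ba (memvf x).
apply: eq_bigr => i _; rewrite -tnth_nth; congr (_ *: _).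
rewrite mulr_sumr linear_sum (bigD1 i) //= big1 => [|j /negPf ji].
  by rewrite -tnth_nth -scalerAr linearZ /= nuba eqxx mulr1 addr0.
by rewrite -tnth_nth -scalerAr linearZ /= nuba eq_sym ji mulr0.
Qed.

Lemma dual_expand_r (c d : 'I_m -> N) x :
  (forall i j, nu (d i * c j) = (i == j)%:R) ->
  x = \sum_(i < m) nu (x * c i) *: d i.
Proof.
move=> dc; set X := [tuple d i | i < m].
have Xd (i : 'I_m) : X`_i = d i by rewrite -tnth_nth tnth_mktuple.
have {1 2}-> := coord_basis (dual_basis dc) (memvf x).
apply: eq_bigr => i _; rewrite Xd; congr (_ *: _).
rewrite mulr_suml linear_sum (bigD1 i) //= big1 => [|j /negPf ji].
  by rewrite Xd -scalerAl linearZ /= dc eqxx mulr1 addr0.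
by rewrite Xd -scalerAl linearZ /= dc ji mulr0.
Qed.

(* Elements of [N (x) N] are handled through an arbitrary bilinear map [F]. *)
Section Bilinear.
Variables (W : lmodType R[i]) (F : N -> N -> W).
Hypothesis Fl : forall y, linear (F^~ y).
Hypothesis Fr : forall x, linear (F x).

Lemma bilin_sumr x (k : 'I_m -> R[i]) (d : 'I_m -> N) :
  F x (\sum_i k i *: d i) = \sum_i k i *: F x (d i).
Proof.
pose G := GRing.isLinear.Build _ _ _ _ (F x) (Fr x).
pose L : {linear N -> W} := HB.pack (F x) G.
rewrite -[F x _]/(L _) linear_sum; apply: eq_bigr => i _.
by rewrite linearZ_LR.
Qed.

Lemma bilin_suml y (k : 'I_m -> R[i]) (d : 'I_m -> N) :
  F (\sum_i k i *: d i) y = \sum_i k i *: F (d i) y.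
Proof.
pose G := GRing.isLinear.Build _ _ _ _ (F^~ y) (Fl y).
pose L : {linear N -> W} := HB.pack (F^~ y) G.
rewrite -[F _ y]/(L _) linear_sum; apply: eq_bigr => i _.
by rewrite linearZ_LR.
Qed.

(** Independence of the dual bases: expand [b_i] in the [d_j], and recombine
the coefficients [nu (b_i c_j)] into the expansion of [c_j] in the [a_i]. *)
Lemma casimir_unique (c d : 'I_m -> N) :
  (forall i j, nu (d i * c j) = (i == j)%:R) ->
  \sum_(i < m) F (tnth a i) (tnth b i) = \sum_(j < m) F (c j) (d j).
Proof.
move=> dc.
transitivity (\sum_(i < m) \sum_(j < m)
    nu (tnth b i * c j) *: F (tnth a i) (d j)).
  apply: eq_bigr => i _.
  by rewrite {1}(dual_expand_r (tnth b i) dc) bilin_sumr.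
rewrite exchange_big; apply: eq_bigr => j _.
by rewrite {2}(dual_expand_l (c j)) bilin_suml.
Qed.

(** Both sides have the coordinate matrix [nu (b_j x a_i)] with respect to the
elements [a_j (x) b_i]. *)
Lemma casimir_slide x :
  \sum_(i < m) F (x * tnth a i) (tnth b i)
  = \sum_(i < m) F (tnth a i) (tnth b i * x).
Proof.
have [_ _ nuba] := hab.
transitivity (\sum_(i < m) \sum_(j < m)
    nu (tnth b j * (x * tnth a i)) *: F (tnth a j) (tnth b i)).
  apply: eq_bigr => i _.
  by rewrite {1}(dual_expand_l (x * tnth a i)) bilin_suml.
rewrite exchange_big; apply: eq_bigr => j _.
rewrite [in RHS](dual_expand_r (tnth b j * x) nuba) bilin_sumr.
by apply: eq_bigr => i _; rewrite mulrA.
Qed.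

End Bilinear.
End Casimir.

(** * The element [e] of a functional with modular automorphism *)

Lemma star1 (R : realType) (N : falgType R[i]) (star : N -> N)
    (norm : N -> R) : is_cstar_algebra star norm -> star 1 = 1.
Proof.
move=> hN; have := cstarM hN (star 1) 1.
by rewrite mulr1 (cstarK hN) mulr1.
Qed.

(** Polarization: positivity on [(1 + y)^* (1 + y)] makes
[nu y + nu (star y)] real; the cases [y = x] and [y = i x] determine
[nu (star x)]. *)
Lemma positive_functional_star (R : realType) (N : falgType R[i])
    (star : N -> N) (norm : N -> R) (nu : {scalar N}) x :
  is_cstar_algebra star norm -> positive_functional star nu ->
  nu (star x) = (nu x)^*.
Proof.
move=> hN nu_pos.
have nu_real y : nu (star y * y) \is Num.real.
  by apply: ger0_real; apply: nu_pos; exists y.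
have sum_real y : nu y + nu (star y) \is Num.real.
  have -> : nu y + nu (star y) = nu (star (1 + y) * (1 + y))
      - nu (star 1 * 1) - nu (star y * y).
    rewrite (cstarD hN) (star1 hN) mulrDl !mulrDr !mul1r mulr1 !linearD /=.
    ring.
  by rewrite !rpredB.
have A := sum_real x; have := sum_real ('i *: x).
rewrite (cstarZ hN) !linearZ /= conjCi => B.
have two : (2%:R : R[i]) != 0 by rewrite pnatr_eq0.
apply: (mulfI two).
have -> : 2%:R * nu (star x) =
    nu x + nu (star x) + 'i * ('i * nu x + - 'i * nu (star x)).
  rewrite mulrDr mulNr mulrN !mulrA -expr2 sqrCi !mulN1r opprK.
  by rewrite mulr_natl mulr2n addrACA subrr add0r.
have -> : 2%:R * (nu x)^* =
   (nu x + nu (star x) - 'i * ('i * nu x + - 'i * nu (star x)))^*.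
  rewrite mulrDr mulNr mulrN !mulrA -expr2 sqrCi !mulN1r opprK.
  rewrite opprD opprK addrACA subrr addr0 -mulr2n.
  by rewrite rmorphMn /= mulr_natl.
rewrite rmorphB /= rmorphM /= conjCi (conj_Creal A) (conj_Creal B).
ring.
Qed.

Section HalfModular.
Variables (R : realType) (N : falgType R[i]) (nu : {scalar N}).
Variables (m : nat) (a b : m.-tuple N).
Hypothesis hab : dual_bases nu a b.
Variables (star : N -> N) (theta thetah : N -> N).
Hypothesis htheta : modular_automorphism nu theta.
Hypothesis hthetah : half_automorphism star theta thetah.

Lemma half_automorphismE : exists h : N,
  [/\ h \is a GRing.unit, exists y, h = star y * y,
      forall x, theta x = h * h * x * (h * h)^-1 &
      forall x, thetah x = h * x * h^-1].
Proof.
have [g [h [_ ug [y hy] hh [th thh]]]] := hthetah.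
exists h; split=> //; first by rewrite -(unitrX_pos h (ltn0Sn 1)) expr2 hh.
  by exists y.
by move=> x; rewrite hh.
Qed.

Lemma thetah_linear : linear thetah.
Proof.
have [h [_ _ _ thh]] := half_automorphismE => k x y.
by rewrite !thh mulrDr mulrDl -scalerAr -scalerAl.
Qed.

Lemma thetahM x y : thetah (x * y) = thetah x * thetah y.
Proof.
have [h [uh _ _ thh]] := half_automorphismE.
by rewrite !thh !mulrA (mulrVK uh).
Qed.

Lemma thetahK x : thetah (thetah x) = theta x.
Proof.
have [h [uh _ th thh]] := half_automorphismE.
by rewrite !thh th invrM // !mulrA.
Qed.

(** [nu (h x h^-1) = nu (x h^-1 theta h)], and [theta] fixes [h], since it is
conjugation by [h ^ 2]. *)
Lemma nu_thetah x : nu (thetah x) = nu x.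
Proof.
have [h [uh _ th thh]] := half_automorphismE.
by rewrite thh -mulrA htheta th invrM // !mulrA (mulrVK uh) !(mulrK uh).
Qed.

Section Bilinear.
Variables (W : lmodType R[i]) (F : N -> N -> W).
Hypothesis Fl : forall y, linear (F^~ y).
Hypothesis Fr : forall x, linear (F x).

Let Frh x : linear (fun y => F x (thetah y)).
Proof. by move=> k y z; rewrite thetah_linear Fr. Qed.

(** The families [thetah b_i] and [thetah^-1 a_i] are again dual to each
other. *)
Lemma casimir_flip :
  \sum_(i < m) F (tnth a i) (thetah (tnth b i))
  = \sum_(i < m) F (thetah (tnth b i)) (tnth a i).
Proof.
have [_ _ nuba] := hab.
have [h [uh _ th thh]] := half_automorphismE.
pose ki x := h^-1 * x * h.
have kiK x : thetah (ki x) = x.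
  by rewrite thh /ki !mulrA divrr // mul1r mulrK.
rewrite (casimir_unique hab (F := fun x y => F x (thetah y))
  (fun y => Fl _) Frh (c := fun i => thetah (tnth b i))
  (d := fun i => ki (tnth a i))) //.
- by apply: eq_bigr => i _; rewrite kiK.
- move=> i j; rewrite -nu_thetah thetahM kiK thetahK -htheta nuba.
  by rewrite eq_sym.
Qed.

(** The families [star a_i] and [theta^-1 (star b_i)] are dual to each other,
because [nu] commutes with the involution. Since [h] is self-adjoint,
[star (thetah b) = thetah^-1 (star b)], which is
[thetah (theta^-1 (star b))]. *)
Lemma casimir_star (norm : N -> R) :
  is_cstar_algebra star norm -> positive_functional star nu ->
  \sum_(i < m) F (star (tnth a i)) (star (thetah (tnth b i)))
  = \sum_(i < m) F (tnth a i) (thetah (tnth b i)).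
Proof.
move=> hN nu_pos; have [_ _ nuba] := hab.
have [h [uh [y hy] th thh]] := half_automorphismE.
have hs : star h = h by rewrite hy (cstarM hN) (cstarK hN).
have hVs : star h^-1 = h^-1.
  apply: (mulIr uh); rewrite mulVr // -[X in _ * X]hs -(cstarM hN) divrr //.
  exact: star1 hN.
pose ti x := h^-1 * h^-1 * x * (h * h).
have tiK x : theta (ti x) = x.
  by rewrite th /ti invrM // !mulrA !(mulrK, mulrVK) // divrr // mul1r.
rewrite [RHS](casimir_unique hab (F := fun x y => F x (thetah y))
  (fun y => Fl _) Frh (c := fun i => star (tnth a i))
  (d := fun i => ti (star (tnth b i)))) //.
- apply: eq_bigr => i _; congr F.
  by rewrite !thh !(cstarM hN) hVs hs /ti !mulrA divrr // mul1r mulrK.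
- move=> i j; rewrite htheta tiK -(cstarM hN).
  by rewrite (positive_functional_star _ hN nu_pos) nuba conjC_nat.
Qed.
End Bilinear.

(** The multiplication rule of [F] is that of [N^o (x) N]. In the product,
the sum is [sum_ij a_j a_i (x) b_i b_j] up to [thetah]; sliding [a_j] gives
[sum_i a_i (x) b_i (sum_j a_j b_j)], and the inner sum is the index. *)
Lemma casimir_idempotent k (F : N -> N -> 'M[R[i]]_k) :
  (forall y, linear (F^~ y)) -> (forall x, linear (F x)) ->
  (forall x y x' y', F x y *m F x' y' = F (x' * x) (y * y')) ->
  index_elt a b = 1 ->
  let P := \sum_(i < m) F (tnth a i) (thetah (tnth b i)) in P *m P = P.
Proof.
move=> Fl Fr FM index1 /=; rewrite mulmx_sumr.
have Frh x z : linear (fun y => F x (thetah (y * z))).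
  by move=> c u v; rewrite mulrDl -scalerAl thetah_linear Fr.
transitivity (\sum_(j < m) \sum_(i < m)
    F (tnth a i) (thetah (tnth b i * (tnth a j * tnth b j)))).
  apply: eq_bigr => j _; rewrite mulmx_suml.
  transitivity (\sum_(i < m)
      F (tnth a j * tnth a i) (thetah (tnth b i * tnth b j))).
    by apply: eq_bigr => i _; rewrite FM thetahM.
  rewrite (casimir_slide hab (F := fun x y => F x (thetah (y * tnth b j)))
    (fun y => Fl _) (fun x => Frh x _)).
  by apply: eq_bigr => i _; rewrite mulrA.
rewrite exchange_big; apply: eq_bigr => i _.
pose G y := F (tnth a i) (thetah (tnth b i * y)).
have Gl : linear G.
  by move=> c u v; rewrite /G mulrDr -scalerAr thetah_linear Fr.
rewrite -[in RHS](mulr1 (tnth b i)) -index1 /index_elt.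
rewrite -[RHS]/(G _) -[LHS]/(\sum_j G (tnth a j * tnth b j)).
have := bilin_sumr (F := fun _ : N => G) (fun _ => Gl) 0 (fun=> 1)
  (fun j : 'I_m => tnth a j * tnth b j).
by under eq_bigr do rewrite scale1r; under [in RHS]eq_bigr do rewrite scale1r.
Qed.

End HalfModular.

Section ActE.
Variables (R : realType) (N : falgType R[i]) (n : nat).
Variables (star : N -> N) (norm : N -> R) (nu : {scalar N}).
Hypothesis hN : is_cstar_algebra star norm.
Hypothesis nu_pos : positive_functional star nu.
Variables (m : nat) (a b : m.-tuple N).
Hypothesis hab : dual_bases nu a b.
Hypothesis index1 : index_elt a b = 1.
Variables (theta thetah : N -> N).
Hypothesis htheta : modular_automorphism nu theta.
Hypothesis hthetah : half_automorphism star theta thetah.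
Implicit Types f g : {linear N -> 'M[R[i]]_n}.

Lemma tens_linear_l f g y : linear (fun x => f x *t g y).
Proof.
move=> c u v; apply/matrixP => i j.
by rewrite linearP !mxE mulrDl mulrA.
Qed.

Lemma tens_linear_r f g x : linear (fun y => f x *t g y).
Proof.
move=> c u v; apply/matrixP => i j.
by rewrite linearP !mxE mulrDr mulrCA.
Qed.

Lemma act_e_flip f g :
  act_e a b thetah f g
  = \sum_(i < m) f (thetah (tnth b i)) *t g (tnth a i).
Proof.
exact: (casimir_flip hab htheta hthetah (F := fun x y => f x *t g y)
  (tens_linear_l f g) (tens_linear_r f g)).
Qed.

Lemma act_e_adjoint f g :
  (forall x, f (star x) = (f x)^t*) -> (forall x, g (star x) = (g x)^t*) ->
  (act_e a b thetah f g)^t* = act_e a b thetah f g.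
Proof.
move=> fs gs.
rewrite -[RHS](casimir_star hab htheta hthetah (F := fun x y => f x *t g y)
  (tens_linear_l f g) (tens_linear_r f g) hN nu_pos).
rewrite /act_e linear_sum /= map_mx_sum /=; apply: eq_bigr => i _.
by rewrite fs gs trmx_tens map_mxT.
Qed.

Lemma act_e_idem_op f g : op_action star f -> action star g ->
  act_e a b thetah f g *m act_e a b thetah f g = act_e a b thetah f g.
Proof.
move=> [fM _] [gM _].
apply: (casimir_idempotent hab hthetah (F := fun x y => f x *t g y)
  (tens_linear_l f g) (tens_linear_r f g)) => // x y x' y'.
by rewrite tensmx_mul fM gM.
Qed.

(** Here the opposite algebra acts on the leg of the [thetah b_i]; flip
invariance moves the [a_i] to that leg. *)
Lemma act_e_idem f g : action star f -> op_action star g ->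
  act_e a b thetah f g *m act_e a b thetah f g = act_e a b thetah f g.
Proof.
move=> [fM _] [gM _]; rewrite act_e_flip.
apply: (casimir_idempotent hab hthetah (F := fun x y => f y *t g x)
  (tens_linear_r f g) (tens_linear_l f g)) => // x y x' y'.
by rewrite tensmx_mul fM gM.
Qed.

End ActE.

(** * Legs of operators on the threefold tensor power *)

Section Legs.
#[local] Arguments mxtens_unindex : simpl never.
Variables (C : numClosedFieldType) (n : nat).
Implicit Types (X Y : 'M[C]_(n * n)) (x : 'M[C]_n) (s t : 'S_3).
Implicit Types (p q : 'I_(n * n * n)) (i j k : 'I_3).

(** Permutations of the three factors relate all legs: each pair of distinct
factors is the image of the first two ([leg_frame]), where a leg is a
Kronecker product with the identity ([leg12E]). *)
Definition reindex3 s p : 'I_(n * n * n) :=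
  mxtens_index (mxtens_index (coord3 p (s 0), coord3 p (s 1)),
                coord3 p (s 2)).

Lemma coord3_reindex3 s p k : coord3 (reindex3 s p) k = coord3 p (s k).
Proof.
rewrite {1}/coord3 /reindex3 !mxtens_indexK /=.
case: k => [[|[|[|//]]] ?]; rewrite (tnth_nth (coord3 p (s 0))) /=;
  by congr (tnth _ (s _)); apply: val_inj.
Qed.

Lemma coord3E p : [/\ (mxtens_unindex (mxtens_unindex p).1).1 = coord3 p 0,
  (mxtens_unindex (mxtens_unindex p).1).2 = coord3 p 1 &
  (mxtens_unindex p).2 = coord3 p 2].
Proof. by []. Qed.

Lemma coord3_inj p q : (forall k, coord3 p k = coord3 q k) -> p = q.
Proof.
move=> pq; have [p0 p1 p2] := coord3E p; have [q0 q1 q2] := coord3E q.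
rewrite -[p]mxtens_unindexK -[q]mxtens_unindexK; congr mxtens_index.
apply: injective_projections; last by rewrite p2 q2.
rewrite -[LHS]mxtens_unindexK -[RHS]mxtens_unindexK; congr mxtens_index.
by apply: injective_projections; rewrite ?p0 ?p1 ?q0 ?q1.
Qed.

Lemma reindex3M s t p : reindex3 s (reindex3 t p) = reindex3 (s * t)%g p.
Proof. by apply: coord3_inj => k; rewrite !coord3_reindex3 permM. Qed.

Lemma reindex3_1 p : reindex3 1%g p = p.
Proof. by apply: coord3_inj => k; rewrite coord3_reindex3 perm1. Qed.

Lemma reindex3K s : cancel (reindex3 s) (reindex3 s^-1%g).
Proof. by move=> p; rewrite reindex3M mulVg reindex3_1. Qed.

Lemma reindex3Kv s : cancel (reindex3 s^-1%g) (reindex3 s).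
Proof. by move=> p; rewrite reindex3M mulgV reindex3_1. Qed.

Lemma reindex3_bij s : bijective (reindex3 s).
Proof. exact: Bijective (reindex3K s) (reindex3Kv s). Qed.

Definition permute3 s (A : 'M[C]_(n * n * n)) : 'M[C]_(n * n * n) :=
  mxsub (reindex3 s) (reindex3 s) A.

Lemma permute3M s A B : permute3 s (A *m B) = permute3 s A *m permute3 s B.
Proof.
apply/matrixP => p q; rewrite !mxE (reindex (reindex3 s)) /=.
  by apply: eq_bigr => r _; rewrite !mxE.
exact: onW_bij (reindex3_bij s).
Qed.

Lemma leg_permute3 s i j X : leg (s i) (s j) X = permute3 s (leg i j X).
Proof.
apply/matrixP => p q; rewrite !mxE !coord3_reindex3; congr (_ * (_ : bool)%:R).
apply/forallP/forallP => h k.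
  have := h (s k); rewrite !inE !(inj_eq perm_inj) !coord3_reindex3.
  exact.
rewrite -(permKV s k); have := h (s^-1 k)%g.
by rewrite !inE !(inj_eq perm_inj) !coord3_reindex3.
Qed.

(** The operator [x] on the [k]-th factor, as the case of one factor of
[leg]. *)
Definition slot k x : 'M[C]_(n * n * n) :=
  \matrix_(p, q) (x (coord3 p k) (coord3 q k)
     * [forall l, (l != k) ==> (coord3 p l == coord3 q l)]%:R).

Lemma slot_permute3 s k x : slot (s k) x = permute3 s (slot k x).
Proof.
apply/matrixP => p q; rewrite !mxE !coord3_reindex3; congr (_ * (_ : bool)%:R).
apply/forallP/forallP => h l.
  have := h (s l); rewrite !(inj_eq perm_inj) !coord3_reindex3.
  exact.
rewrite -(permKV s l); have := h (s^-1 l)%g.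
by rewrite !(inj_eq perm_inj) !coord3_reindex3.
Qed.

Lemma forall_ord3 (P : pred 'I_3) : [forall k, P k] = [&& P 0, P 1 & P 2].
Proof.
apply/forallP/and3P => [h|[h0 h1 h2] k]; first by split; apply: h.
case: k => [[|[|[|//]]] hk].
- by rewrite (_ : Ordinal hk = 0) //; apply: val_inj.
- by rewrite (_ : Ordinal hk = 1) //; apply: val_inj.
- by rewrite (_ : Ordinal hk = 2) //; apply: val_inj.
Qed.

Lemma leg12E X : leg 0 1 X = X *t 1%:M.
Proof.
apply/matrixP => p q; rewrite !mxE forall_ord3 /=.
have [p0 p1 p2] := coord3E p; have [q0 q1 q2] := coord3E q.
rewrite -p0 -p1 -q0 -q1 -!surjective_pairing !mxtens_unindexK.
by rewrite -p2 -q2.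
Qed.

Lemma slot3E x : slot 2 x = 1%:M *t x.
Proof.
apply/matrixP => p q; rewrite !mxE forall_ord3 /= andbT.
have [p0 p1 p2] := coord3E p; have [q0 q1 q2] := coord3E q.
rewrite mulrC -p0 -p1 -q0 -q1 -p2 -q2; congr (_%:R * _).
by rewrite -(inj_eq (can_inj (@mxtens_unindexK n n))) -pair_eqE.
Qed.

Lemma leg_frame i j : i != j -> exists2 s : 'S_3, s 0 = i & s 1 = j.
Proof.
move=> ij; pose t : 'S_3 := tperm 0 i.
have t0 : t 0 = i by exact: tpermL.
have t1 : t 1 != i by rewrite -t0 (inj_eq perm_inj).
pose u : 'S_3 := tperm (t 1) j.
exists (t * u)%g; last by rewrite permM tpermL.
by rewrite permM t0 tpermD // eq_sym.
Qed.

Lemma legM i j X Y : i != j -> leg i j (X *m Y) = leg i j X *m leg i j Y.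
Proof.
move=> /leg_frame [s <- <-].
by rewrite !leg_permute3 -permute3M !leg12E tensmx_mul mulmx1.
Qed.

Lemma leg_adjoint i j X : (leg i j X)^t* = leg i j (X^t*).
Proof.
apply/matrixP => p q; rewrite !mxE rmorphM rmorph_nat.
congr (_ * (_ : bool)%:R).
by apply: eq_forallb => k; rewrite eq_sym.
Qed.

Lemma leg_sum i j I (r : seq I) (X : I -> 'M[C]_(n * n)) :
  leg i j (\sum_(a <- r) X a) = \sum_(a <- r) leg i j (X a).
Proof.
apply/matrixP => p q; rewrite !(mxE, summxE) mulr_suml.
by apply: eq_bigr => a _; rewrite !mxE.
Qed.

Lemma leg_tens1 i j x : i != j -> leg i j (x *t 1%:M) = slot i x.
Proof.
move=> /leg_frame [s <- <-]; rewrite leg_permute3 slot_permute3; congr permute3.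
apply/matrixP => p q; rewrite mxE tensmxE !mxE !forall_ord3 /=.
by rewrite -mulrA -natrM mulnb.
Qed.

Lemma leg_1tens i j x : i != j -> leg i j (1%:M *t x) = slot j x.
Proof.
move=> /leg_frame [s <- <-]; rewrite leg_permute3 slot_permute3; congr permute3.
apply/matrixP => p q; rewrite mxE tensmxE !mxE !forall_ord3 /=.
by rewrite mulrAC mulrC -natrM mulnb.
Qed.

Lemma leg_tens i j x y : i != j ->
  leg i j (x *t y) = slot i x *m slot j y.
Proof.
move=> ij; rewrite -(leg_tens1 x ij) -(leg_1tens y ij) -legM //.
by rewrite tensmx_mul mulmx1 mul1mx.
Qed.

(** After a permutation, the operators are [X (x) 1] and [1 (x) x]. *)
Lemma leg_slotC i j k X x : i != j -> k != i -> k != j ->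
  leg i j X *m slot k x = slot k x *m leg i j X.
Proof.
move=> /leg_frame [s <- <-].
rewrite -(permKV s k) !(inj_eq perm_inj); move: (s^-1 k)%g => l l0 l1.
have -> : l = 2.
  case: l l0 l1 => [[|[|[|//]]] ?] l0 l1; apply: val_inj => //=.
rewrite leg_permute3 slot_permute3 -!permute3M leg12E slot3E.
by rewrite !tensmx_mul !mulmx1 !mul1mx.
Qed.

Definition perm_mx3 s : 'M[C]_(n * n * n) :=
  \matrix_(p, q) (q == reindex3 s p)%:R.

Lemma mul_perm_mx3 s m (A : 'M_(_, m)) :
  perm_mx3 s *m A = rowsub (reindex3 s) A.
Proof.
apply/matrixP => p q; rewrite !mxE (bigD1 (reindex3 s p)) //= big1 => [|r rp].
  by rewrite mxE eqxx mul1r addr0.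
by rewrite mxE (negPf rp) mul0r.
Qed.

Lemma perm_mx3_comm s A : perm_mx3 s *m A = permute3 s A *m perm_mx3 s.
Proof.
rewrite mul_perm_mx3; apply/matrixP => p q; rewrite !mxE.
rewrite (bigD1 (reindex3 s^-1%g q)) //= big1 => [|r rp].
  by rewrite !mxE reindex3Kv eqxx mulr1 addr0.
rewrite !mxE (_ : q == _ = false) ?mulr0 //.
by apply: contraNF rp => /eqP ->; rewrite reindex3K.
Qed.

Lemma perm_mx3_leg s i j X :
  perm_mx3 s *m leg i j X = leg (s i) (s j) X *m perm_mx3 s.
Proof. by rewrite perm_mx3_comm -leg_permute3. Qed.

Lemma perm_mx3M s t : perm_mx3 s *m perm_mx3 t = perm_mx3 (t * s)%g.
Proof.
rewrite mul_perm_mx3; apply/matrixP => p q; rewrite !mxE.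
by rewrite reindex3M.
Qed.

Lemma perm_mx3_1 : perm_mx3 1%g = 1%:M.
Proof.
by apply/matrixP => p q; rewrite !mxE reindex3_1 eq_sym.
Qed.

Lemma eq_reindex3 p q s : (q == reindex3 s p) =
  [&& coord3 q 0 == coord3 p (s 0), coord3 q 1 == coord3 p (s 1)
    & coord3 q 2 == coord3 p (s 2)].
Proof.
rewrite -(forall_ord3 (fun k => coord3 q k == coord3 p (s k))).
apply/eqP/forallP => [-> k|h]; first by rewrite coord3_reindex3.
by apply: coord3_inj => k; rewrite coord3_reindex3; apply/eqP.
Qed.

Lemma leg_flip i j : i != j -> leg i j (flip C n) = perm_mx3 (tperm i j).
Proof.
move=> ij; apply/matrixP => p q; rewrite !mxE !mxtens_indexK /=.
rewrite -natrM mulnb; congr (_ : bool)%:R.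
apply/andP/eqP => [[/andP[/eqP pq /eqP qp] /forallP h]|->].
  apply: coord3_inj => k; rewrite coord3_reindex3.
  case: tpermP => [->|->|/eqP ki /eqP kj] //.
  by have := h k; rewrite !inE negb_or ki kj => /eqP.
rewrite !coord3_reindex3 tpermL tpermR !eqxx; split=> //.
apply/forallP => k; apply/implyP; rewrite !inE negb_or => /andP[ki kj].
by rewrite coord3_reindex3 tpermD // eq_sym.
Qed.

Definition cycle3 : 'S_3 := (tperm 0%R 1%R * tperm 0%R 2%R)%g.

Lemma cycle3E : [/\ cycle3 0 = 1, cycle3 1 = 2 & cycle3 2 = 0].
Proof.
split; rewrite permM.
- by rewrite tpermL tpermD.
- by rewrite tpermR tpermL.
- by rewrite (tpermD (x := 0) (y := 1)) // tpermR.
Qed.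

Lemma cycle12_3E : cycle12_3 C n = perm_mx3 cycle3.
Proof.
have [c0 c1 c2] := cycle3E.
apply/matrixP => p q; rewrite !mxE eq_reindex3 c0 c1 c2.
by rewrite andbC -andbA !(eq_sym (coord3 q _)).
Qed.

(** On vectors: x (x) y (x) z |-> x (x) z (x) y |-> y (x) x (x) z
|-> x (x) y (x) z. *)
Lemma flip_cycle_flip :
  leg12 (flip C n) *m cycle12_3 C n *m leg23 (flip C n) = 1%:M.
Proof.
rewrite /leg12 /leg23 cycle12_3E !leg_flip // !perm_mx3M -perm_mx3_1.
congr perm_mx3.
have := cycle3E; move: cycle3 => c [c0 c1 c2].
apply/permP => k; rewrite perm1.
suff: [forall k, (tperm 1%R 2%R * (c * tperm 0%R 1%R))%g k == k].
  by move=> /forallP /(_ k) /eqP.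
rewrite forall_ord3 !permM tpermL tpermR (tpermD (x := 1) (y := 2)) //.
by rewrite c0 c1 c2 tpermL tpermR tpermD.
Qed.

Lemma leg13E X :
  leg12 (flip C n) *m leg23 X *m cycle12_3 C n *m leg23 (flip C n) = leg13 X.
Proof.
have -> : leg12 (flip C n) *m leg23 X = leg13 X *m leg12 (flip C n).
  by rewrite /leg12 /leg23 leg_flip // perm_mx3_leg tpermR tpermD.
by rewrite -2!mulmxA (mulmxA (leg12 _)) flip_cycle_flip mulmx1.
Qed.

Lemma cycle_flip_leg13 X :
  cycle12_3 C n *m (leg23 (flip C n) *m leg13 X)
  = leg23 X *m (cycle12_3 C n *m leg23 (flip C n)).
Proof.
have [c0 c1 _] := cycle3E.
rewrite /leg23 /leg13 cycle12_3E leg_flip // perm_mx3_leg tpermR tpermD //.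
rewrite mulmxA.
by rewrite perm_mx3_leg c0 c1 mulmxA.
Qed.

End Legs.

(** * Extending a unitary between subspaces by zero *)

Section PartialIsometry.
Variables (C : numClosedFieldType) (n : nat).
Implicit Types (E Eh U X Y : 'M[C]_n).

Lemma adjointM m p q (A : 'M[C]_(m, p)) (B : 'M[C]_(p, q)) :
  (A *m B)^t* = B^t* *m A^t*.
Proof. by rewrite trmx_mul map_mxM. Qed.

Lemma eq_mulmx_cV m p (A B : 'M[C]_(m, p)) :
  (forall v : 'cV_p, A *m v = B *m v) -> A = B.
Proof.
move=> AB; apply/matrixP => i j; have := AB (delta_mx j 0).
by rewrite -!colE => /matrixP /(_ i 0); rewrite !mxE.
Qed.

Lemma eq_adjoint_form m p (A B : 'M[C]_(m, p)) :
  (forall (v : 'cV_m) (w : 'cV_p), v^t* *m (A *m w) = v^t* *m (B *m w)) ->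
  A = B.
Proof.
move=> AB; apply: eq_mulmx_cV => w; apply/row_matrixP => i.
rewrite !rowE -[delta_mx 0 i]trmxCK trmx_delta map_delta_mx.
exact: AB.
Qed.

Lemma in_range_mul m (P : 'M[C]_m) (w : 'cV_m) : in_range P (P *m w).
Proof. by exists w. Qed.

Section Unitary.
Variables E Eh U : 'M[C]_n.
Hypothesis EE : E *m E = E.
Hypothesis EhEh : Eh *m Eh = Eh.
Hypothesis Eadj : E^t* = E.
Hypothesis Ehadj : Eh^t* = Eh.
Hypothesis Urange : forall v, in_range Eh v -> in_range E (U *m v).
Let V := E *m U *m Eh.

Lemma extension_range : V = U *m Eh.
Proof.
apply: eq_mulmx_cV => v; rewrite /V -!mulmxA.
by have [w ->] := Urange (in_range_mul Eh v); rewrite mulmxA EE.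
Qed.

Lemma extension_initial :
  (forall v w, in_range Eh v -> in_range Eh w ->
    (U *m v)^t* *m (U *m w) = v^t* *m w) ->
  V^t* *m V = Eh.
Proof.
move=> Uiso; apply: eq_adjoint_form => v w.
rewrite -[_ *m V *m w]mulmxA mulmxA -adjointM extension_range -!mulmxA.
rewrite (Uiso _ _ (in_range_mul _ _) (in_range_mul _ _)).
by rewrite adjointM Ehadj -mulmxA (mulmxA Eh) EhEh.
Qed.

(** [V V^*] is the identity on the range of [V], which is the range of [E] by
surjectivity, and [V^* E = V^*]. *)
Lemma extension_final : V^t* *m V = Eh ->
  (forall w, in_range E w -> exists2 v, in_range Eh v & U *m v = w) ->
  V *m V^t* = E.
Proof.
move=> VV Usurj.
have VE : V^t* *m E = V^t*.
  by rewrite -{1}Eadj -adjointM /V !mulmxA EE.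
have VEh : V *m Eh = V by rewrite /V -(mulmxA _ Eh Eh) EhEh.
have UEh := extension_range.
move: (V) VV VE VEh UEh => W WW WE WEh UEh.
suff <- : W *m W^t* *m E = E by rewrite -mulmxA WE.
apply: eq_mulmx_cV => w.
have [_ [z ->] Ew] := Usurj _ (in_range_mul E w).
rewrite -!mulmxA -Ew (mulmxA U) -UEh (mulmxA (W^t* )) WW mulmxA.
by rewrite WEh.
Qed.

(** The commutation hypotheses let [X] act first on the range of [Eh], and
extend the relation by zero to the complement. *)
Lemma extension_intertwine X Y : Eh *m X = X *m Eh -> E *m Y = Y *m E ->
  (forall v, in_range Eh v -> U *m (X *m v) = Y *m (U *m v)) ->
  V *m X = Y *m V.
Proof.
move=> XEh YE UXY; apply: eq_mulmx_cV => v.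
rewrite /V -!mulmxA (mulmxA Eh) XEh -mulmxA UXY; last exact: in_range_mul.
by rewrite mulmxA YE -mulmxA.
Qed.

End Unitary.

(** On [v = Eh12 Eh23 w] the left side is [U23 Eh23 V12 w = V23 V12 w]. On the
right side, [U23 v = V23 Eh12 w = Eh13 V23 w]; the permutations [F23] and [Z]
carry [Eh13] to [Eh23], which turns the next [U23] into [V23], hence the
middle factor into [V13]; finally [Eh12] may be inserted in front of
[V13 V23], which turns the last [U12] into [V12]. *)
Lemma pentagon_extension (U12 U23 Eh12 Eh13 Eh23 F12 Z F23 : 'M[C]_n)
    (V12 V13 V23 : 'M[C]_n) :
  V12 = U12 *m Eh12 -> V23 = U23 *m Eh23 ->
  F12 *m V23 *m Z *m F23 = V13 ->
  Z *m (F23 *m Eh13) = Eh23 *m (Z *m F23) ->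
  Eh12 *m Eh23 = Eh23 *m Eh12 ->
  V12 *m Eh23 = Eh23 *m V12 ->
  V23 *m Eh12 = Eh13 *m V23 ->
  Eh12 *m V13 *m V23 = V13 *m V23 ->
  (forall v, in_range (Eh12 *m Eh23) v ->
     U23 *m (U12 *m v)
     = U12 *m (F12 *m (U23 *m (Z *m (F23 *m (U23 *m v)))))) ->
  V23 *m V12 = V12 *m V13 *m V23.
Proof.
move=> V12E V23E V13E ZF EhC V12Eh V23Eh V13V23 pentagon.
apply: eq_mulmx_cV => w; set v := Eh12 *m Eh23 *m w.
have U12v : U12 *m v = Eh23 *m (V12 *m w).
  by rewrite /v !mulmxA -V12E V12Eh.
have U23v : U23 *m v = Eh13 *m (V23 *m w).
  by rewrite /v EhC !mulmxA -V23E V23Eh.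
have := pentagon v (in_range_mul _ w); rewrite U12v U23v.
have -> : Z *m (F23 *m (Eh13 *m (V23 *m w)))
          = Eh23 *m (Z *m (F23 *m (V23 *m w))).
  by have := congr1 (mulmx^~ (V23 *m w)) ZF; rewrite /= -!mulmxA.
rewrite (mulmxA U23) -V23E (mulmxA U23) -V23E mulmxA => ->.
have -> : F12 *m (V23 *m (Z *m (F23 *m (V23 *m w))))
          = Eh12 *m (V13 *m (V23 *m w)).
  by have := congr1 (mulmx^~ w) V13V23; rewrite /= -V13E -!mulmxA => ->.
by rewrite mulmxA -V12E !mulmxA.
Qed.

End PartialIsometry.

(** * Moving legs of [V] past legs of [E] and [Eh] *)

Section Transport.
Variables (R : realType) (N : falgType R[i]) (n : nat).
Variables (star : N -> N) (nu : {scalar N}).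
Variables (m : nat) (a b : m.-tuple N).
Hypothesis hab : dual_bases nu a b.
Variables (theta thetah : N -> N).
Hypothesis htheta : modular_automorphism nu theta.
Hypothesis hthetah : half_automorphism star theta thetah.
Implicit Types f g : {linear N -> 'M[R[i]]_n}.
Local Notation act_e := (act_e a b thetah).

Lemma slotC i j (x y : 'M[R[i]]_n) : i != j ->
  slot i x *m slot j y = slot j y *m slot i x.
Proof.
move=> ij; rewrite -(leg_tens1 x ij) -(leg_1tens y ij) -!(legM _ _ ij); congr leg.
by rewrite !tensmx_mul !(mulmx1, mul1mx).
Qed.

Lemma leg_act_e i j f g : i != j ->
  leg i j (act_e f g)
  = \sum_(k < m) slot i (f (tnth a k)) *m slot j (g (thetah (tnth b k))).
Proof.
by move=> ij; rewrite leg_sum; apply: eq_bigr => k _; rewrite leg_tens.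
Qed.

Lemma leg_act_e_flip i j f g : i != j ->
  leg i j (act_e f g) = leg j i (act_e g f).
Proof.
move=> ij; rewrite (act_e_flip hab htheta hthetah) leg_sum.
rewrite leg_act_e 1?eq_sym //.
by apply: eq_bigr => k _; rewrite (leg_tens _ _ ij); exact: slotC.
Qed.

(** [leg i j (act_e f g)] is the same combination of operators on the factors
[i] and [j] for all [f] and [g], so that intertwining the actions suffices. *)
Lemma transport_act_e (A : 'M[R[i]]_(n * n * n)) i j i' j' f g f' g' :
  i != j -> i' != j' ->
  (forall x, A *m slot i (f x) = slot i' (f' x) *m A) ->
  (forall x, A *m slot j (g x) = slot j' (g' x) *m A) ->
  A *m leg i j (act_e f g) = leg i' j' (act_e f' g') *m A.
Proof.
move=> ij ij' Af Ag; rewrite !leg_act_e // mulmx_sumr mulmx_suml.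
by apply: eq_bigr => k _; rewrite mulmxA Af -mulmxA Ag mulmxA.
Qed.

Lemma act_e_comm_l f g (x : 'M[R[i]]_n) :
  (forall y, f y *m x = x *m f y) ->
  act_e f g *m (x *t 1%:M) = (x *t 1%:M) *m act_e f g.
Proof.
move=> fx; rewrite mulmx_suml mulmx_sumr; apply: eq_bigr => k _.
by rewrite !tensmx_mul fx mulmx1 mul1mx.
Qed.

Lemma act_e_comm_r f g (x : 'M[R[i]]_n) :
  (forall y, g y *m x = x *m g y) ->
  act_e f g *m (1%:M *t x) = (1%:M *t x) *m act_e f g.
Proof.
move=> gx; rewrite mulmx_suml mulmx_sumr; apply: eq_bigr => k _.
by rewrite !tensmx_mul gx mulmx1 mul1mx.
Qed.

Section Intertwiner.
Variables (alpha beta betah : {linear N -> 'M[R[i]]_n}).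
Variable V : 'M[R[i]]_(n * n).
Hypothesis Vbeta2 : forall x,
  V *m (1%:M *t beta x) = (betah x *t 1%:M) *m V.
Hypothesis Vbeta1 : forall x,
  V *m (beta x *t 1%:M) = (beta x *t 1%:M) *m V.
Hypothesis Vbetah2 : forall x,
  V *m (1%:M *t betah x) = (1%:M *t betah x) *m V.
Hypothesis Valpha1 : forall x,
  V *m (alpha x *t 1%:M) = (1%:M *t alpha x) *m V.
Let E := act_e alpha beta.
Let Eh := act_e betah alpha.

Lemma leg_beta1 i j x : i != j ->
  leg i j V *m slot i (beta x) = slot i (beta x) *m leg i j V.
Proof. by move=> ij; rewrite -(leg_tens1 _ ij) -!legM // Vbeta1. Qed.

Lemma leg_beta2 i j x : i != j ->
  leg i j V *m slot j (beta x) = slot i (betah x) *m leg i j V.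
Proof.
by move=> ij; rewrite -(leg_tens1 _ ij) -(leg_1tens _ ij) -!legM // Vbeta2.
Qed.

Lemma leg_betah2 i j x : i != j ->
  leg i j V *m slot j (betah x) = slot j (betah x) *m leg i j V.
Proof. by move=> ij; rewrite -(leg_1tens _ ij) -!legM // Vbetah2. Qed.

Lemma leg_alpha1 i j x : i != j ->
  leg i j V *m slot i (alpha x) = slot j (alpha x) *m leg i j V.
Proof.
by move=> ij; rewrite -(leg_tens1 _ ij) -(leg_1tens _ ij) -!legM // Valpha1.
Qed.

Lemma initial23_comm12 : leg12 V *m leg23 Eh = leg23 Eh *m leg12 V.
Proof.
by apply: transport_act_e => [||x|x]; [ | | exact: leg_betah2 | exact: leg_slotC].
Qed.

Lemma final12_comm23 : leg23 V *m leg12 E = leg12 E *m leg23 V.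
Proof.
by apply: transport_act_e => [||x|x]; [ | | exact: leg_slotC | exact: leg_beta1].
Qed.

(** Writing [E_23] with the factors exchanged puts [beta], on factor 3,
first; [V_13] carries it to [betah] on factor 1 and does not touch [alpha] on
factor 2, which gives [Eh_12]. *)
Lemma final23_initial12 : leg13 V *m leg23 E = leg12 Eh *m leg13 V.
Proof.
rewrite {1}/leg23 (leg_act_e_flip _ _ (isT : (1 : 'I_3) != 2)).
by apply: transport_act_e => [||x|x]; [ | | exact: leg_beta2 | exact: leg_slotC].
Qed.

Lemma initial12_initial13 : leg23 V *m leg12 Eh = leg13 Eh *m leg23 V.
Proof.
by apply: transport_act_e => [||x|x]; [ | | exact: leg_slotC | exact: leg_alpha1].
Qed.

Lemma initial_legsC : (forall x y, alpha x *m betah y = betah y *m alpha x) ->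
  leg12 Eh *m leg23 Eh = leg23 Eh *m leg12 Eh.
Proof.
move=> ab; apply: transport_act_e => [//|//|x|x]; last exact: leg_slotC.
rewrite -(leg_1tens _ (isT : (0 : 'I_3) != 1)) -!legM //.
by rewrite act_e_comm_r.
Qed.

End Intertwiner.
End Transport.

(** * Multiplicativity *)

Theorem mainTheorem5 (R : realType) (N : falgType R[i])
    (star : N -> N) (norm : N -> R) (hN : is_cstar_algebra star norm)
    (nu : {scalar N})
    (nu_pos : positive_functional star nu) (nu_faithful : faithful star nu)
    (m : nat) (a b : m.-tuple N) (hab : dual_bases nu a b)
    (nu_index1 : index_elt a b = 1)
    (theta thetah : N -> N) (htheta : modular_automorphism nu theta)
    (hthetah : half_automorphism star theta thetah)
    (n : nat) (beta alpha betah : {linear N -> 'M[R[i]]_n})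
    (hbeta : action star beta) (halpha : op_action star alpha)
    (hbetah : action star betah)
    (hba : commuting beta alpha) (hbbh : commuting beta betah)
    (habh : commuting alpha betah)
    (E Eh U : 'M[R[i]]_(n * n))
    (hE : E = act_e a b thetah alpha beta)
    (hEh : Eh = act_e a b thetah betah alpha)
    (hU : pseudo_mult_unitary beta alpha betah E Eh U) :
  let V := E *m U *m Eh in
  [/\ mult_partial_isometry V, V *m V^t* = E & V^t* *m V = Eh].
Proof.
move=> V.
have EE : E *m E = E.
  by rewrite hE (act_e_idem_op hab nu_index1 hthetah halpha hbeta).
have EhEh : Eh *m Eh = Eh.
  by rewrite hEh (act_e_idem hab nu_index1 htheta hthetah hbetah halpha).
have [[_ bs] [_ as_] [_ bhs]] := And3 hbeta halpha hbetah.
have Eadj : E^t* = E.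
  by rewrite hE (act_e_adjoint hN nu_pos hab htheta hthetah as_ bs).
have Ehadj : Eh^t* = Eh.
  by rewrite hEh (act_e_adjoint hN nu_pos hab htheta hthetah bhs as_).
have VEh : V = U *m Eh by exact: (extension_range EE (pmu_range hU)).
have VV : V^t* *m V = Eh.
  exact: (extension_initial EE EhEh Ehadj (pmu_range hU) (pmu_isometry hU)).
have VVs : V *m V^t* = E.
  exact: (extension_final EE EhEh Eadj (pmu_range hU) VV (pmu_surjective hU)).
have EV : E *m V = V by rewrite /V !mulmxA EE.
have Vbeta1 x : V *m (beta x *t 1%:M) = (beta x *t 1%:M) *m V.
  apply: extension_intertwine => [||v]; last exact: (pmu_beta1 hU).
    by rewrite hEh act_e_comm_l // => y; rewrite hbbh.
  by rewrite hE act_e_comm_l // => y; rewrite hba.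
have Vbeta2 x : V *m (1%:M *t beta x) = (betah x *t 1%:M) *m V.
  apply: extension_intertwine => [||v]; last exact: (pmu_beta2 hU).
    by rewrite hEh act_e_comm_r // => y; rewrite hba.
  by rewrite hE act_e_comm_l // => y; rewrite habh.
have Vbetah2 x : V *m (1%:M *t betah x) = (1%:M *t betah x) *m V.
  apply: extension_intertwine => [||v]; last exact: (pmu_betah2 hU).
    by rewrite hEh act_e_comm_r // => y; rewrite habh.
  by rewrite hE act_e_comm_r // => y; rewrite hbbh.
have Valpha1 x : V *m (alpha x *t 1%:M) = (1%:M *t alpha x) *m V.
  apply: extension_intertwine => [||v]; last exact: (pmu_alpha1 hU).
    by rewrite hEh act_e_comm_l // => y; rewrite habh.
  by rewrite hE act_e_comm_r // => y; rewrite hba.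
have V12Eh23 : leg12 V *m leg23 Eh = leg23 Eh *m leg12 V.
  by rewrite hEh; exact: initial23_comm12.
have V23E12 : leg23 V *m leg12 E = leg12 E *m leg23 V.
  by rewrite hE; exact: final12_comm23.
have V13E23 : leg13 V *m leg23 E = leg12 Eh *m leg13 V.
  rewrite hE hEh.
  exact: (final23_initial12 hab htheta hthetah _ Vbeta2).
have V23Eh12 : leg23 V *m leg12 Eh = leg13 Eh *m leg23 V.
  by rewrite hEh; exact: initial12_initial13.
have Ehlegs : leg12 Eh *m leg23 Eh = leg23 Eh *m leg12 Eh.
  by rewrite hEh; exact: initial_legsC.
have VEh_leg i j : i != j -> leg i j V = leg i j U *m leg i j Eh.
  by move=> ij; rewrite -(legM _ _ ij) -VEh.
(* Because [E V = V], the final projection may be inserted before [V_23]. *)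
have V13V23 : leg12 Eh *m leg13 V *m leg23 V = leg13 V *m leg23 V.
  rewrite -V13E23 -mulmxA; congr (_ *m _).
  by rewrite -(legM E V (isT : (1 : 'I_3) != 2)) EV.
have final_leg i j : i != j -> leg i j V *m (leg i j V)^t* = leg i j E.
  by move=> ij; rewrite leg_adjoint -(legM _ _ ij) VVs.
have initial_leg i j : i != j -> (leg i j V)^t* *m leg i j V = leg i j Eh.
  by move=> ij; rewrite leg_adjoint -(legM _ _ ij) VV.
have V12E : leg12 V = leg12 U *m leg12 Eh by exact: VEh_leg.
have V23E : leg23 V = leg23 U *m leg23 Eh by exact: VEh_leg.
have V12f : leg12 V *m (leg12 V)^t* = leg12 E by exact: final_leg.
have V23f : leg23 V *m (leg23 V)^t* = leg23 E by exact: final_leg.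
have V12i : (leg12 V)^t* *m leg12 V = leg12 Eh by exact: initial_leg.
have V23i : (leg23 V)^t* *m leg23 V = leg23 Eh by exact: initial_leg.
split; [split | exact: VVs | exact: VV].
- by rewrite VVs.
- exact: (pentagon_extension V12E V23E (leg13E V) (cycle_flip_leg13 Eh)
    Ehlegs V12Eh23 V23Eh12 V13V23 (pmu_pentagon hU)).
- rewrite -[LHS]mulmxA V23f V12i; exact: V13E23.
- rewrite -[RHS]mulmxA V12f; exact: esym V23E12.
- rewrite -[LHS]mulmxA V23i; exact: V12Eh23.
Qed.
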